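(* For all $n\ge2$ and $P,Q\in\Gamma_n$, $$\tfrac14\Delta(P\Vert Q)\le I(P\Vert Q)\le h(P\Vert Q)\le4\,d(P\Vert Q)\le\tfrac18J(P\Vert Q)\le T(P\Vert Q)\le\tfrac1{16}\Psi(P\Vert Q).$$
   Context: $\Gamma_n=\{P=(p_1,\dots,p_n): p_i>0,\ \sum_{i=1}^n p_i=1\}$. For $P,Q\in\Gamma_n$ (all sums over $i=1,\dots,n$): $\Delta(P\Vert Q)=\sum\frac{(p_i-q_i)^2}{p_i+q_i}$; $I(P\Vert Q)=\frac12\left[\sum p_i\ln\left(\frac{2p_i}{p_i+q_i}\right)+\sum q_i\ln\left(\frac{2q_i}{p_i+q_i}\right)\right]$; $h(P\Vert Q)=\frac12\sum(\sqrt{p_i}-\sqrt{q_i})^2$; $d(P\Vert Q)=1-\sum\left(\frac{\sqrt{p_i}+\sqrt{q_i}}{2}\right)\sqrt{\frac{p_i+q_i}{2}}$; $J(P\Vert Q)=\sum(p_i-q_i)\ln\left(\frac{p_i}{q_i}\right)$; $T(P\Vert Q)=\sum\left(\frac{p_i+q_i}{2}\right)\ln\left(\frac{p_i+q_i}{2\sqrt{p_iq_i}}\right)$; $\Psi(P\Vert Q)=\sum\frac{(p_i-q_i)^2(p_i+q_i)}{p_iq_i}$. *)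

(* Defs.v *)
From HB Require Import structures.
From mathcomp Require Import all_boot all_order all_algebra.
From mathcomp Require Import reals exp.

Set Implicit Arguments.
Unset Strict Implicit.
Unset Printing Implicit Defensive.

Import Order.TTheory GRing.Theory Num.Theory.
Local Open Scope ring_scope.

Definition Gamma (R : realType) (n : nat) (P : 'I_n -> R) : Prop :=
  (forall i : 'I_n, 0 < P i) /\ \sum_(i < n) P i = 1.

Section Divergences.
Variables (R : realType) (n : nat).
Implicit Types P Q : 'I_n -> R.

Definition triangular_discrimination P Q : R :=
  \sum_(i < n) (P i - Q i) ^+ 2 / (P i + Q i).

Definition JS_divergence P Q : R :=
  1 / 2 * (\sum_(i < n) P i * ln (2 * P i / (P i + Q i))
           + \sum_(i < n) Q i * ln (2 * Q i / (P i + Q i))).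

Definition hellinger P Q : R :=
  1 / 2 * \sum_(i < n) (Num.sqrt (P i) - Num.sqrt (Q i)) ^+ 2.

Definition d_divergence P Q : R :=
  1 - \sum_(i < n) (Num.sqrt (P i) + Num.sqrt (Q i)) / 2
                   * Num.sqrt ((P i + Q i) / 2).

Definition J_divergence P Q : R :=
  \sum_(i < n) (P i - Q i) * ln (P i / Q i).

Definition AG_divergence P Q : R :=
  \sum_(i < n) (P i + Q i) / 2
               * ln ((P i + Q i) / (2 * Num.sqrt (P i * Q i))).

Definition sym_chi2_divergence P Q : R :=
  \sum_(i < n) (P i - Q i) ^+ 2 * (P i + Q i) / (P i * Q i).

End Divergences.

(* Main.v *)
Require Import Defs.
From HB Require Import structures.
From mathcomp Require Import all_boot all_order all_algebra.
From mathcomp Require Import ring lra.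
From mathcomp Require Import boolp classical_sets functions reals topology normedtype derive.
From mathcomp Require Import realfun exp.

Import Order.TTheory GRing.Theory Num.Theory.
Import numFieldNormedType.Exports.
Local Open Scope ring_scope.

(** The chain already holds coordinate by coordinate, provided that the constant
    [1] of [d_divergence] is first distributed over the coordinates as the sum
    of the arithmetic means of [P i] and [Q i].  All seven summands are then
    homogeneous of degree one and symmetric in [(p, q)], so writing
    [p = s (1 + t)] and [q = s (1 - t)] with [-1 < t < 1] factors out [s] and
    leaves seven even functions of [t].  With [u = sqrt (1 + t)],
    [v = sqrt (1 - t)], [L = ln (1 + t) - ln (1 - t)] and
    [F = (1 + t) ln (1 + t) + (1 - t) ln (1 - t)], the chain reads

      [t^2 / 2 <= F / 2 <= 1 - u v <= 4 (1 - (u + v) / 2) <= t L / 4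
         <= - (ln (1 + t) + ln (1 - t)) / 2 <= t^2 / (2 (1 - t^2))].

    All of them agree with [t^2 / 2] up to terms of order four, so no crude
    estimate can work, but two bounds on [L] for [0 <= t < 1] suffice:
    [2 t + 2 t^3 / 3 <= L <= 2 t / (1 - t^2)] ([ln_ratio_ge], [ln_ratio_le]).
    The first two inequalities and the fifth follow by differentiation, because
    the derivative of each difference is a multiple of the gap between [L] and
    [2 t], [2 t / sqrt (1 - t^2)] and [2 t / (1 - t^2)] respectively.  The third
    is [(u + v - 2)^2 >= 0], as [u^2 + v^2 = 2].  The fourth is the cubic lower
    bound taken at [(u - v) / (u + v)] instead of [t], where [L] becomes
    [ln u - ln v] ([lnB_ge_mean]).  The last one is [ln (1 + x) <= x]. *)

(** * Sign of a function from the sign of its derivative *)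

Lemma ge0_of_derive_ge0 (R : realType) (f df : R -> R) (t : R) :
  f 0 = 0 ->
  (forall x : R, 0 <= x < 1 -> is_derive x 1 f (df x)) ->
  (forall x : R, 0 <= x < 1 -> 0 <= df x) ->
  0 <= t < 1 -> 0 <= f t.
Proof.
move=> f0 fdf df0 /andP[t0 t1].
have lt1 (x : R) : x \in `[0, t] -> 0 <= x < 1.
  by rewrite in_itv/= => /andP[-> /le_lt_trans->].
have [y /subset_itv_oo_cc/lt1||c] := @MVT_segment R f df 0 t t0.
- exact: fdf.
- apply: derivable_within_continuous => x /lt1 x01.
  by have [] := fdf _ x01.
- by move/lt1/df0 => dfc; rewrite f0 subr0 => ->; rewrite subr0 mulr_ge0.
Qed.

(** Every one-variable inequality below that is proved by differentiation has
    this form: polynomial multiples of [ln (1 + t)] and [ln (1 - t)] plus a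
    remainder. *)
Lemma ln_combination_ge0 (R : realType) (A B : {poly R}) (r dr : R -> R)
    (t : R) :
  r 0 = 0 ->
  (forall x : R, 0 <= x < 1 -> is_derive x 1 r (dr x)) ->
  (forall x : R, 0 <= x < 1 ->
     0 <= A^`().[x] * ln (1 + x) + A.[x] / (1 + x)
          + (B^`().[x] * ln (1 - x) - B.[x] / (1 - x)) + dr x) ->
  0 <= t < 1 -> 0 <= A.[t] * ln (1 + t) + B.[t] * ln (1 - t) + r t.
Proof.
move=> r0 rdr df0.
apply: (@ge0_of_derive_ge0 R
  (fun y => A.[y] * ln (1 + y) + B.[y] * ln (1 - y) + r y)); last exact: df0.
  by rewrite addr0 subr0 ln1 !mulr0 !add0r r0.
move=> x x01; have /andP[x0 x1] := x01.
have xp : 0 < 1 + x by lra.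
have xm : 0 < 1 - x by lra.
have lnp : is_derive x 1 (fun y : R => ln (1 + y)) (1 + x)^-1.
  have -> : (fun y : R => ln (1 + y)) = @ln R \o (cst 1 + id) by [].
  rewrite -[X in is_derive _ _ _ X]mulr1 -[X in _ * X]add0r.
  by apply: is_derive1_comp; apply: is_derive1_ln.
have lnm : is_derive x 1 (fun y : R => ln (1 - y)) (- (1 - x)^-1).
  have -> : (fun y : R => ln (1 - y)) = @ln R \o (cst 1 - id) by [].
  rewrite -[X in is_derive _ _ _ X]mulrN1 -[X in _ * X]sub0r.
  by apply: is_derive1_comp; apply: is_derive1_ln.
apply: is_derive_eq.
  exact: (is_deriveD (is_deriveD (is_deriveM (is_derive_poly A x) lnp)
                                 (is_deriveM (is_derive_poly B x) lnm))
                     (rdr x x01)).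
rewrite /GRing.scale/=; ring.
Qed.

(** * Bounds for the logarithm of a quotient *)

(** The left side is the start of the power series of the right side; the
    derivative of the difference is [2 x^4 / (1 - x^2)].  The cubic term is what
    [lnB_ge_mean] needs: with [2 t] alone that inequality would fail. *)
Lemma ln_ratio_ge (R : realType) (t : R) : 0 <= t < 1 ->
  2 * t + 2 / 3 * t ^+ 3 <= ln (1 + t) - ln (1 - t).
Proof.
move=> t01.
pose r : {poly R} := (- 2)%:P * 'X - (2 / 3)%:P * 'X ^+ 3.
suff: 0 <= 1%:P.[t] * ln (1 + t) + (-1)%:P.[t] * ln (1 - t) + r.[t].
  by rewrite !hornerE /=; lra.
apply: (@ln_combination_ge0 R _ _ (horner r) (fun x => r^`().[x])) => //.
  by rewrite !hornerE /=; ring.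
move=> x /andP[x0 x1]; rewrite /r !poly.derivE !hornerE /=.
have xp : 1 + x != 0 by rewrite lt0r_neq0 //; lra.
have xm : 1 - x != 0 by rewrite lt0r_neq0 //; lra.
rewrite [leRHS](_ : _ = 2 * x ^+ 4 / ((1 + x) * (1 - x))); last first.
  by field; rewrite xp xm.
by rewrite divr_ge0 ?mulr_ge0 ?exprn_ge0 //; lra.
Qed.

(** The factor [1 - t^2] is kept on the left so that the difference has derivative
    [2 x (ln (1 + x) - ln (1 - x))], nonnegative by [ln_ratio_ge]. *)
Lemma ln_ratio_le (R : realType) (t : R) : 0 <= t < 1 ->
  (1 - t ^+ 2) * (ln (1 + t) - ln (1 - t)) <= 2 * t.
Proof.
move=> t01.
pose A : {poly R} := 1 - 'X ^+ 2.
pose r : {poly R} := 2%:P * 'X.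
suff: 0 <= (- A).[t] * ln (1 + t) + A.[t] * ln (1 - t) + r.[t].
  by rewrite !hornerE /=; lra.
apply: (@ln_combination_ge0 R _ _ (horner r) (fun x => r^`().[x])) => //.
  by rewrite !hornerE /=; ring.
move=> x x01; rewrite /r /A !poly.derivE !hornerE /=.
have xp : 1 + x != 0 by rewrite lt0r_neq0 //; lra.
have xm : 1 - x != 0 by rewrite lt0r_neq0 //; lra.
rewrite [leRHS](_ : _ = 2 * x * (ln (1 + x) - ln (1 - x))); last first.
  by field; rewrite xp xm.
have := ln_ratio_ge R x x01.
have : 0 <= x ^+ 3 by rewrite exprn_ge0; lra.
by move=> ? ?; rewrite mulr_ge0; lra.
Qed.

(** The Cayley substitution [t = (u - v) / (u + v)], for which
    [u / v = (1 + t) / (1 - t)]; it turns the two bounds above into bounds on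
    [ln u - ln v]. *)
Lemma lnB_ratio (R : realType) (u v : R) : 0 < v <= u ->
  exists t : R, [/\ 0 <= t < 1, t = (u - v) / (u + v)
    & ln u - ln v = ln (1 + t) - ln (1 - t)].
Proof.
move=> /andP[v0 vu]; have u0 : 0 < u by lra.
have uv0 : 0 < u + v by lra.
have uvn0 : u + v != 0 by rewrite lt0r_neq0.
exists ((u - v) / (u + v)); split => //.
  by rewrite divr_ge0 ?ltr_pdivrMr //; lra.
have -> : 1 + (u - v) / (u + v) = 2 / (u + v) * u by field.
have -> : 1 - (u - v) / (u + v) = 2 / (u + v) * v by field.
by rewrite !(@lnM _ (2 / (u + v))) ?posrE ?divr_gt0 //; ring.
Qed.

(** This is [2 ln y <= y - 1 / y] at [y = u / v].  Used with [u = sqrt (1 + t)]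
    and [v = sqrt (1 - t)], it gives the bound [2 t / sqrt (1 - t^2)] on
    [ln (1 + t) - ln (1 - t)], sharper than [ln_ratio_le]. *)
Lemma lnB_le (R : realType) (u v : R) : 0 < v <= u ->
  2 * (u * v) * (ln u - ln v) <= u ^+ 2 - v ^+ 2.
Proof.
move=> /[dup] /andP[v0 vu] /lnB_ratio[t [t01 tE ->]].
have uv0 : 0 < u + v by lra.
have uvn0 : u + v != 0 by rewrite lt0r_neq0.
have := ln_ratio_le R t t01.
rewrite -(ler_pM2l (_ : 0 < (u + v) ^+ 2 / 2)) ?divr_gt0 ?exprn_gt0 //.
rewrite (mulrA _ (1 - t ^+ 2)).
have -> : (u + v) ^+ 2 / 2 * (1 - t ^+ 2) = 2 * (u * v) by rewrite tE; field.
by have -> : (u + v) ^+ 2 / 2 * (2 * t) = u ^+ 2 - v ^+ 2 by rewrite tE; field.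
Qed.

(** In terms of [m = (u + v) / 2] and [w = (u - v) / 2], which satisfy
    [m^2 + w^2 = 1], the cubic lower bound at [w / m] reduces the claim to
    [0 <= (1 - m)^2 (1 + 2 m (1 - m))], true because [m <= 1]. *)
Lemma lnB_ge_mean (R : realType) (u v : R) : 0 < v <= u ->
  u ^+ 2 + v ^+ 2 = 2 ->
  4 * (1 - (u + v) / 2) <= (u ^+ 2 - v ^+ 2) / 4 * (ln u - ln v).
Proof.
move=> /[dup] /andP[v0 vu] /lnB_ratio[t [t01 tE ->]] uv2.
pose m := (u + v) / 2; pose w := (u - v) / 2.
have m0 : 0 < m by rewrite /m; lra.
have mn0 : m != 0 by rewrite lt0r_neq0.
have w0 : 0 <= w by rewrite /w; lra.
have mw1 : w ^+ 2 = 1 - m ^+ 2 by rewrite /m /w; nra.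
have m1 : m <= 1 by nra.
have -> : (u ^+ 2 - v ^+ 2) / 4 = m * w by rewrite /m /w; field.
have -> : (u + v) / 2 = m by [].
have tm : t = w / m by rewrite tE /m /w; field; rewrite lt0r_neq0; lra.
apply: (@le_trans _ _ (m * w * (2 * t + 2 / 3 * t ^+ 3))); last first.
  by apply: ler_wpM2l (ln_ratio_ge R t t01); rewrite mulr_ge0 // ltW.
have -> : m * w * (2 * t + 2 / 3 * t ^+ 3)
          = 2 / 3 * w ^+ 2 * (3 + w ^+ 2 / m ^+ 2) by rewrite tm; field.
rewrite mw1 -subr_ge0.
rewrite [leRHS](_ : _ = 2 / 3 * ((1 - m) ^+ 2 * (1 + 2 * m * (1 - m)))
                        / m ^+ 2); last by field.
have hm : 0 <= 1 + 2 * m * (1 - m) by nra.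
by rewrite divr_ge0 ?sqr_ge0 // mulr_ge0 ?mulr_ge0 ?sqr_ge0 //; lra.
Qed.

(** * The inequalities in one variable *)

(** The derivative of the difference is [ln (1 + x) - ln (1 - x) - 2 x]. *)
Lemma sqr_le_entropy (R : realType) (t : R) : 0 <= t < 1 ->
  t ^+ 2 <= (1 + t) * ln (1 + t) + (1 - t) * ln (1 - t).
Proof.
move=> t01.
pose r : {poly R} := - 'X ^+ 2.
suff: 0 <= (1 + 'X : {poly R}).[t] * ln (1 + t)
           + (1 - 'X : {poly R}).[t] * ln (1 - t) + r.[t].
  by rewrite !hornerE /=; lra.
apply: (@ln_combination_ge0 R _ _ (horner r) (fun x => r^`().[x])) => //.
  by rewrite !hornerE /=; ring.
move=> x x01; rewrite /r !poly.derivE !hornerE /=.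
have xp : 1 + x != 0 by rewrite lt0r_neq0 //; lra.
have xm : 1 - x != 0 by rewrite lt0r_neq0 //; lra.
rewrite [leRHS](_ : _ = ln (1 + x) - ln (1 - x) - 2 * x); last first.
  by field; rewrite xp xm.
have := ln_ratio_ge R x x01.
have : 0 <= x ^+ 3 by rewrite exprn_ge0; lra.
lra.
Qed.

(** The derivative of the difference is
    [2 x / sqrt (1 - x^2) - (ln (1 + x) - ln (1 - x))], nonnegative by [lnB_le]
    applied to the square roots of [1 + x] and [1 - x]. *)
Lemma entropy_le_sqrt (R : realType) (t : R) : 0 <= t < 1 ->
  (1 + t) * ln (1 + t) + (1 - t) * ln (1 - t)
  <= 2 * (1 - Num.sqrt (1 + t) * Num.sqrt (1 - t)).
Proof.
move=> t01.
pose r (x : R) := 2 - 2 * Num.sqrt (1 - 'X ^+ 2 : {poly R}).[x].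
have sqE (x : R) : 0 <= x < 1 -> Num.sqrt (1 - 'X ^+ 2 : {poly R}).[x]
    = Num.sqrt (1 + x) * Num.sqrt (1 - x).
  move=> x01; rewrite -sqrtrM; last lra.
  by congr Num.sqrt; rewrite !hornerE /=; ring.
suff: 0 <= (- (1 + 'X) : {poly R}).[t] * ln (1 + t)
           + (- (1 - 'X) : {poly R}).[t] * ln (1 - t) + r t.
  by rewrite /r sqE // !hornerE /=; lra.
apply: (@ln_combination_ge0 R _ _ r
  (fun x => 2 * x / (Num.sqrt (1 + x) * Num.sqrt (1 - x)))) => //.
- by rewrite /r sqE ?lexx ?ltr01 // addr0 subr0 sqrtr1; ring.
- move=> x x01.
  have q0 : 0 < (1 - 'X ^+ 2 : {poly R}).[x].
    by rewrite !hornerE /=; nra.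
  have -> : r = cst 2 - 2 *: (Num.sqrt \o horner (1 - 'X ^+ 2 : {poly R})).
    by [].
  apply: is_derive_eq.
    apply: is_deriveB; apply: is_deriveZ; apply: is_derive1_comp.
    exact: is_derive1_sqrt.
  rewrite sqE // !poly.derivE !hornerE /= /GRing.scale /=.
  have ? : Num.sqrt (1 + x) != 0 by rewrite lt0r_neq0 // sqrtr_gt0; lra.
  have ? : Num.sqrt (1 - x) != 0 by rewrite lt0r_neq0 // sqrtr_gt0; lra.
  by field; apply/andP.
move=> x x01; rewrite !poly.derivE !hornerE /=.
have xp : 1 + x != 0 by rewrite lt0r_neq0 //; lra.
have xm : 1 - x != 0 by rewrite lt0r_neq0 //; lra.
set u := Num.sqrt (1 + x); set v := Num.sqrt (1 - x).
have u2 : u ^+ 2 = 1 + x by rewrite sqr_sqrtr; lra.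
have v2 : v ^+ 2 = 1 - x by rewrite sqr_sqrtr; lra.
have v0 : 0 < v by rewrite sqrtr_gt0; lra.
have vu : v <= u by rewrite ler_wsqrtr; lra.
have u0 : 0 < u by lra.
rewrite [leRHS](_ : _ = 2 * x / (u * v) - (ln (1 + x) - ln (1 - x))); last first.
  by field; rewrite xp xm !lt0r_neq0.
rewrite subr_ge0 ler_pdivlMr ?mulr_gt0 //.
have := lnB_le R u v; rewrite v0 vu => /(_ isT).
rewrite -u2 -v2 !lnXn // u2 v2 !mulr2n; lra.
Qed.

(** Twice the difference has derivative
    [2 x / (1 - x^2) - (ln (1 + x) - ln (1 - x))], nonnegative by
    [ln_ratio_le]. *)
Lemma ln_ratio_le_ln_prod (R : realType) (t : R) : 0 <= t < 1 ->
  t / 2 * (ln (1 + t) - ln (1 - t)) <= - (ln (1 + t) + ln (1 - t)).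
Proof.
move=> t01.
suff: 0 <= (- (2%:P + 'X) : {poly R}).[t] * ln (1 + t)
           + (- (2%:P - 'X) : {poly R}).[t] * ln (1 - t) + cst 0 t.
  by rewrite !hornerE /=; lra.
apply: (@ln_combination_ge0 R _ _ _ (cst 0)) => //.
move=> x x01; rewrite !poly.derivE !hornerE /=.
have xp : 0 < 1 + x by lra.
have xm : 0 < 1 - x by lra.
rewrite [leRHS](_ : _ = 2 * x / (1 - x ^+ 2) - (ln (1 + x) - ln (1 - x))).
  have := ln_ratio_le R x x01.
  by rewrite subr_ge0 ler_pdivlMr 1?mulrC //; nra.
by field; rewrite !lt0r_neq0 //; nra.
Qed.

(** The chain for [p = 1 + t] and [q = 1 - t].  All its terms are even in [t], so
    it is enough to treat [0 <= t], where the bounds above apply. *)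
Lemma divergence_chain_unit (R : realType) (t : R)
    (u := Num.sqrt (1 + t)) (v := Num.sqrt (1 - t)) : -1 < t < 1 ->
  [/\ t ^+ 2 / 2 <= 1 / 2 * ((1 + t) * ln (1 + t) + (1 - t) * ln (1 - t)),
      1 / 2 * ((1 + t) * ln (1 + t) + (1 - t) * ln (1 - t)) <= 1 - u * v,
      1 - u * v <= 4 * (1 - (u + v) / 2)
    & [/\ 4 * (1 - (u + v) / 2) <= t / 4 * (ln (1 + t) - ln (1 - t)),
          t / 4 * (ln (1 + t) - ln (1 - t)) <= - (ln (1 + t) + ln (1 - t)) / 2
        & - (ln (1 + t) + ln (1 - t)) / 2 <= t ^+ 2 / (2 * (1 - t ^+ 2))]].
Proof.
wlog t0 : t @u @v / 0 <= t => [hw|].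
  case: (leP 0 t) => [|t0 /andP[t1 t2]]; first exact: hw.
  have := hw (- t); rewrite opprK sqrrN oppr_ge0 (ltW t0) => /(_ isT).
  rewrite -/u -/v => -[|h1 h2 h3 [h4 h5 h6]]; first lra.
  by split; [| | |split]; lra.
move=> /andP[_ t1]; have t01 : 0 <= t < 1 by rewrite t0.
have u2 : u ^+ 2 = 1 + t by rewrite sqr_sqrtr; lra.
have v2 : v ^+ 2 = 1 - t by rewrite sqr_sqrtr; lra.
have v0 : 0 < v by rewrite sqrtr_gt0; lra.
have vu : v <= u by rewrite ler_wsqrtr; lra.
have u0 : 0 < u by lra.
split.
- by have := sqr_le_entropy R t t01; lra.
- by have := entropy_le_sqrt R t t01; rewrite -/u -/v; lra.
(* The gap is half of this square. *)
- by have := sqr_ge0 (u + v - 2); nra.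
split.
- have := lnB_ge_mean R u v; rewrite v0 vu => /(_ isT).
  have -> : u ^+ 2 + v ^+ 2 = 2 by lra.
  move=> /(_ erefl) /le_trans; apply.
  by rewrite -u2 -v2 !lnXn // u2 v2 !mulr2n; lra.
- by have := ln_ratio_le_ln_prod R t t01; lra.
have t2 : 0 < 1 - t ^+ 2 by nra.
have -> : ln (1 + t) + ln (1 - t) = - ln (1 - t ^+ 2)^-1.
  rewrite lnV ?posrE // opprK -lnM ?posrE; [|lra|lra].
  by congr ln; ring.
(* Use [ln (1 + x) <= x] at [x = t^2 / (1 - t^2)]: [1 + x = 1 / (1 - t^2)]. *)
have : -1 < t ^+ 2 / (1 - t ^+ 2).
  apply: (@lt_le_trans _ _ 0); first by rewrite ltrN10.
  by apply: divr_ge0; [exact: sqr_ge0 | exact: ltW].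
move=> /le_ln1Dx.
have -> : 1 + t ^+ 2 / (1 - t ^+ 2) = (1 - t ^+ 2)^-1.
  by field; rewrite lt0r_neq0.
have -> : t ^+ 2 / (2 * (1 - t ^+ 2)) = t ^+ 2 / (1 - t ^+ 2) / 2.
  by field; rewrite lt0r_neq0.
lra.
Qed.

(** * From one variable to distributions *)

(** The summands are homogeneous of degree one, so this is
    [divergence_chain_unit] multiplied by [s = (p + q) / 2], at
    [t = (p - q) / (p + q)].  In [d] the mean [(p + q) / 2] replaces the
    coordinate-free constant [1] of [d_divergence]. *)
Lemma divergence_chain_coordinate (R : realType) (p q : R) : 0 < p -> 0 < q ->
  let I := 1 / 2 * (p * ln (2 * p / (p + q)) + q * ln (2 * q / (p + q))) in
  let h := 1 / 2 * (Num.sqrt p - Num.sqrt q) ^+ 2 in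
  let d := (p + q) / 2
           - (Num.sqrt p + Num.sqrt q) / 2 * Num.sqrt ((p + q) / 2) in
  let J := (p - q) * ln (p / q) in
  let T := (p + q) / 2 * ln ((p + q) / (2 * Num.sqrt (p * q))) in
  [/\ 1 / 4 * ((p - q) ^+ 2 / (p + q)) <= I, I <= h, h <= 4 * d
    & [/\ 4 * d <= 1 / 8 * J, 1 / 8 * J <= T
        & T <= 1 / 16 * ((p - q) ^+ 2 * (p + q) / (p * q))]].
Proof.
move=> p0 q0.
pose s := (p + q) / 2; pose t := (p - q) / (p + q).
have pq0 : 0 < p + q by lra.
have pqn0 : p + q != 0 by rewrite lt0r_neq0.
have s0 : 0 < s by rewrite divr_gt0.
have pE : p = s * (1 + t) by rewrite /s /t; field.
have qE : q = s * (1 - t) by rewrite /s /t; field.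
have tp : 0 < 1 + t by rewrite -(pmulr_rgt0 _ s0) -pE.
have tm : 0 < 1 - t by rewrite -(pmulr_rgt0 _ s0) -qE.
clearbody s t; subst p q; clear p0 q0 pq0 pqn0.
have -> : s * (1 + t) + s * (1 - t) = 2 * s by ring.
have -> : 2 * s / 2 = s by field.
have sn0 : s != 0 by rewrite lt0r_neq0.
have tpn0 : 1 + t != 0 by rewrite lt0r_neq0.
have tmn0 : 1 - t != 0 by rewrite lt0r_neq0.
have -> : 2 * (s * (1 + t)) / (2 * s) = 1 + t by field.
have -> : 2 * (s * (1 - t)) / (2 * s) = 1 - t by field.
have -> : s * (1 + t) / (s * (1 - t)) = (1 + t) / (1 - t).
  by field; rewrite tmn0 sn0.
have -> : s * (1 + t) * (s * (1 - t)) = s ^+ 2 * ((1 + t) * (1 - t)) by ring.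
rewrite ln_div ?posrE // (@sqrtrM _ (s ^+ 2)) ?sqr_ge0 // sqrtr_sqr.
rewrite (gtr0_norm s0) (@sqrtrM _ (1 + t)) ?(ltW tp) // !(@sqrtrM _ s) ?ltW //.
have /divergence_chain_unit[] : -1 < t < 1 by lra.
set u := Num.sqrt (1 + t); set v := Num.sqrt (1 - t); set r := Num.sqrt s.
have r2 : r ^+ 2 = s by rewrite sqr_sqrtr // ltW.
have u2 : u ^+ 2 = 1 + t by rewrite sqr_sqrtr // ltW.
have v2 : v ^+ 2 = 1 - t by rewrite sqr_sqrtr // ltW.
have u0 : 0 < u by rewrite sqrtr_gt0.
have v0 : 0 < v by rewrite sqrtr_gt0.
have -> : 2 * s / (2 * (s * (u * v))) = (u * v)^-1.
  by field; rewrite !lt0r_neq0.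
have -> : ln (u * v)^-1 = - (ln (1 + t) + ln (1 - t)) / 2.
  rewrite lnV ?posrE ?mulr_gt0 // lnM ?posrE //.
  by rewrite -u2 -v2 !lnXn // !mulr2n; field.
move=> h1 h2 h3 [h4 h5 h6] I h d J T.
pose Lp := ln (1 + t); pose Lm := ln (1 - t).
have -> : I = s * (1 / 2 * ((1 + t) * Lp + (1 - t) * Lm)).
  by rewrite /I -/Lp -/Lm; ring.
have -> : h = s * (1 - u * v).
  have -> : h = 1 / 2 * (r ^+ 2 * (u ^+ 2 + v ^+ 2 - 2 * (u * v))).
    by rewrite /h; ring.
  by rewrite r2 u2 v2; field.
have -> : 4 * d = s * (4 * (1 - (u + v) / 2)).
  have -> : 4 * d = 4 * (s - r ^+ 2 * ((u + v) / 2)) by rewrite /d; ring.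
  by rewrite r2; ring.
have -> : 1 / 8 * J = s * (t / 4 * (Lp - Lm)).
  by rewrite /J -/Lp -/Lm; field.
have -> : 1 / 4 * ((s * (1 + t) - s * (1 - t)) ^+ 2 / (2 * s))
          = s * (t ^+ 2 / 2) by field.
have -> : 1 / 16 * ((s * (1 + t) - s * (1 - t)) ^+ 2 * (2 * s)
                     / (s ^+ 2 * ((1 + t) * (1 - t))))
          = s * (t ^+ 2 / (2 * (1 - t ^+ 2))).
  have -> : 1 - t ^+ 2 = (1 + t) * (1 - t) by ring.
  by field; rewrite sn0 tpn0 tmn0.
by rewrite /T !ler_pM2l.
Qed.

Theorem mainTheorem16 (R : realType) (n : nat) (hn : (2 <= n)%N)
    (P Q : 'I_n -> R) (hP : Gamma P) (hQ : Gamma Q) :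
  1 / 4 * triangular_discrimination P Q <= JS_divergence P Q
  /\ JS_divergence P Q <= hellinger P Q
  /\ hellinger P Q <= 4 * d_divergence P Q
  /\ 4 * d_divergence P Q <= 1 / 8 * J_divergence P Q
  /\ 1 / 8 * J_divergence P Q <= AG_divergence P Q
  /\ AG_divergence P Q <= 1 / 16 * sym_chi2_divergence P Q.
Proof.
have [P0 P1] := hP; have [Q0 Q1] := hQ.
have chain i := divergence_chain_coordinate R (P i) (Q i) (P0 i) (Q0 i).
(* Both distributions have total mass one, so the means sum to one. *)
have -> : d_divergence P Q = \sum_(i < n) ((P i + Q i) / 2
    - (Num.sqrt (P i) + Num.sqrt (Q i)) / 2 * Num.sqrt ((P i + Q i) / 2)).
  by rewrite sumrB -mulr_suml big_split /= P1 Q1; congr (_ - _); field.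
rewrite /triangular_discrimination /JS_divergence /hellinger /J_divergence
        /AG_divergence /sym_chi2_divergence -big_split /= !mulr_sumr.
by do !split; apply: ler_sum => i _; have [? ? ? []] := chain i.
Qed.
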